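(* Let $k,\lambda,\varepsilon>0$. For each $n\ge2$ let weights $\alpha_{1,n},\dots,\alpha_{n,n}>0$ with $\sum_{i=1}^n\alpha_{i,n}=1$ be given, and let $\alpha_{\min,n}$, $\alpha_{\max,n}$ be the smallest and largest of them. Let $P_n$ be the probability on $[0,\infty)^n$ with density $\lambda^n e^{-\lambda\|x\|_1}$, where $\|x\|_1=\sum_i x_i$. Then there exists $N=N(k,\varepsilon)$ such that for every $n\ge N$, $$P_n\left\{(1-\varepsilon)e^{-n\alpha_{\max,n}\gamma}<\frac{\prod_{i=1}^n x_i^{\alpha_{i,n}}}{\sum_{i=1}^n\alpha_{i,n}x_i}<(1+\varepsilon)e^{-n\alpha_{\min,n}\gamma}\right\}\ge1-\frac1{n^k}.$$
   Context: $\gamma$ denotes Euler's constant. *)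

(* Defs.v *)
From HB Require Import structures.
From mathcomp Require Import all_boot all_order all_algebra.
From mathcomp Require Import all_classical all_reals all_analysis.
Set Implicit Arguments. Unset Strict Implicit. Unset Printing Implicit Defensive.
Import Order.TTheory GRing.Theory Num.Theory.
Import numFieldNormedType.Exports.
Local Open Scope classical_set_scope.
Local Open Scope ring_scope.

Definition euler_gamma (R : realType) : R :=
  lim ((fun n : nat => \sum_(k < n) (k.+1%:R)^-1 - ln (n%:R : R)) @ \oo).

Fixpoint iter_lebesgue_integral (R : realType) (n : nat) :
    (n.-tuple R -> \bar R) -> \bar R :=
  match n with
  | 0 => fun f => f [tuple]
  | m.+1 => fun f =>
      (\int[@lebesgue_measure R]_(t in [set: R])
         iter_lebesgue_integral (fun x : m.-tuple R => f [tuple of t :: x]))%E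
  end.

Definition exp_density (R : realType) (n : nat) (lam : R) (x : n.-tuple R) : R :=
  if [forall i, 0 <= tnth x i]
  then lam ^+ n * expR (- lam * \sum_(i < n) tnth x i)
  else 0.

Definition Pn (R : realType) (n : nat) (lam : R) (A : set (n.-tuple R)) : \bar R :=
  iter_lebesgue_integral (fun x => ((\1_A x) * exp_density lam x)%:E).

(* largest / smallest weight (the weights are positive, so the default
   values 0 resp. the maximum do not affect the result for n >= 1) *)
Definition wmax (R : realType) (n : nat) (a : 'I_n -> R) : R :=
  \big[Num.max/0]_(i < n) a i.
Definition wmin (R : realType) (n : nat) (a : 'I_n -> R) : R :=
  \big[Num.min/wmax a]_(i < n) a i.

Definition gm_am_ratio (R : realType) (n : nat) (a : 'I_n -> R) (x : n.-tuple R) : R :=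
  (\prod_(i < n) (tnth x i) `^ (a i)) / (\sum_(i < n) a i * tnth x i).

(* Main.v *)
Require Import Defs.
From HB Require Import structures.
From mathcomp Require Import all_boot all_order all_algebra.
From mathcomp Require Import all_classical all_reals all_analysis.
From mathcomp Require Import measurable_realfun ring lra.
Import Order.TTheory GRing.Theory Num.Theory.
Import numFieldNormedType.Exports.
Local Open Scope classical_set_scope.
Local Open Scope ring_scope.

(** Put y_i = lam x_i, so the y_i are independent standard exponentials, and let
    g be Euler's constant, M = n wmax >= 1 and m = n wmin <= 1. The ratio is
    scale invariant. If sum a_i ln y_i is not much below -g(M+1)/2 and
    sum a_i y_i not much above 1 + g(M-1)/2 <= e^(g(M-1)/2), the ratio is not
    much below e^(-gM). If the uniform means of ln y_i and y_i are close to -g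
    and 1, weighted AM-GM bounds the ratio by (e^(-g))^m up to a small factor.
    For M large the weighted means need not concentrate, but then the margin
    g(M-1)/2 makes the Chernoff bound exponentially small in n all the same.

    The moment generating functions of ln y and y are at most
    exp(mean * r + 5 r^2) for |r| <= 1/2. For ln y this is a bound on
    Gamma(1 + r), obtained from Gamma(n + 1 + r) = Gamma(1 + r) prod (k + r),
    the log-convexity estimate Gamma(n + 1 + r) <~ n! n^r, and H_n - ln n -> g. *)

(** * Euler's constant *)

Section EulerGamma.
Context {R : realType}.
Implicit Types x : R.

Definition euler_seq (n : nat) : R := \sum_(k < n) (k.+1%:R)^-1 - ln (n%:R : R).

Lemma lnB1_le x : 0 < x -> ln x <= x - 1.
Proof.
move=> x0; have := @le_ln1Dx R (x - 1).
by rewrite (_ : 1 + (x - 1) = x); [apply; lra|ring].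
Qed.

(** By [ln x <= x - 1] at x = (n+1)/(n+2), the increment of [ln] is at least the new harmonic term
    1/(n+2). *)
Lemma euler_seq_step n : euler_seq n.+2 <= euler_seq n.+1.
Proof.
rewrite /euler_seq [in leLHS]big_ord_recr /=.
have h1 : 0 < n.+1%:R :> R by rewrite ltr0n.
have h2 : 0 < n.+2%:R :> R by rewrite ltr0n.
have := @lnB1_le (n.+1%:R / n.+2%:R); rewrite divr_gt0// => /(_ isT).
rewrite ln_div ?posrE//.
have -> : n.+1%:R / n.+2%:R - 1 = - (n.+2%:R)^-1 :> R.
  by rewrite -[n.+2%:R]natr1; move: (n.+1%:R) h1 => t t0; field; lra.
move: (ln n.+1%:R) (ln n.+2%:R) (n.+2%:R^-1) (\sum_(i < n.+1) _) => ? ? ? ?; lra.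
Qed.

Lemma euler_seq_lb n : 1 - ln 2 <= euler_seq n.+1.
Proof.
(* With the argument of [ln] moved one step ahead the sequence is nondecreasing, so an induction can
   start from its first value 1 - ln 2. *)
suff : 1 - ln 2 <= \sum_(k < n.+1) (k.+1%:R)^-1 - ln (n.+2%:R : R).
  have : ln (n.+1%:R : R) <= ln n.+2%:R by rewrite ler_ln ?posrE ?ler_nat ?ltr0n.
  rewrite /euler_seq; move: (ln _) (ln _) (\sum_(i < n.+1) _) => ? ? ?; lra.
elim: n => [|n ih]; first by rewrite big_ord1 invr1.
rewrite big_ord_recr /=.
have h1 : 0 < n.+2%:R :> R by rewrite ltr0n.
have h2 : 0 < n.+3%:R :> R by rewrite ltr0n.
have := @lnB1_le (n.+3%:R / n.+2%:R); rewrite divr_gt0// => /(_ isT).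
rewrite ln_div ?posrE//.
have -> : n.+3%:R / n.+2%:R - 1 = (n.+2%:R)^-1 :> R.
  by rewrite -[n.+3%:R]natr1; move: (n.+2%:R) h1 => t t0; field; lra.
move: ih; move: (ln n.+3%:R) (ln n.+2%:R) (n.+2%:R^-1) (\sum_(i < n.+1) _) => ? ? ? ?; lra.
Qed.

Lemma cvg_euler_seq : euler_seq n @[n --> \oo] --> euler_gamma R.
Proof.
suff : cvgn (fun n => euler_seq n.+1).
  move=> /cvg_ex[l]; rewrite (@cvg_shiftS _ euler_seq) => ul.
  by rewrite /euler_gamma -/euler_seq (_ : lim _ = l)//; exact: cvg_lim.
apply: nonincreasing_is_cvgn.
  by apply/nonincreasing_seqP => n; exact: euler_seq_step.
by exists (1 - ln 2) => _ [n _ <-]; exact: euler_seq_lb.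
Qed.

Lemma euler_gamma_gt0 : 0 < euler_gamma R.
Proof.
have ln2 : ln 2 < 1 :> R.
  rewrite -ltr_expR lnK ?posrE//.
  by have := @expR_gt1Dx R 1 (oner_neq0 _); rewrite -[1 + 1]/(2%:R).
apply: (@lt_le_trans _ _ (1 - ln 2)); first lra.
rewrite -(cvg_lim _ cvg_euler_seq)//; apply: limr_ge; first exact: cvg_euler_seq.
by near=> n; rewrite -(@prednK n) ?euler_seq_lb//; near: n; exists 1%N.
Unshelve. all: by end_near. Qed.

End EulerGamma.

(** * The Gamma integral *)

Section GammaMoments.
Context {R : realType}.
Variable lam : R.
Hypothesis lam0 : 0 < lam.
Notation mu := (@lebesgue_measure R).
Implicit Types x z r p : R.

(** Write 1/(1+x) as 1 - x/(1+x) and use 1 + u <= e^u; the exponent is -x + x^2/(1+x), where 1 + x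
    >= 1/2. *)
Lemma inv1D_le_expR x : `|x| <= 2^-1 -> (1 + x)^-1 <= expR (- x + 2 * x ^+ 2).
Proof.
rewrite ler_norml => /andP[x1 x2].
have x0 : 0 < 1 + x by lra.
have -> : (1 + x)^-1 = 1 + (- x / (1 + x)) by field; lra.
apply: (le_trans (expR_ge1Dx _)); rewrite ler_expR.
rewrite ler_pdivrMr//; nra.
Qed.

(** For x > 0 this is the exponential density times (lam x)^z, so its integral over (0, oo) is
    Gamma(1 + z). *)
Definition gamma_kernel z x : R := lam * expR (z * ln (lam * x) - lam * x).

Definition gamma_moment z : \bar R :=
  (\int[mu]_(x in `]0%R, +oo[) (gamma_kernel z x)%:E)%E.

Lemma gamma_kernel_ge0 z x : 0 <= gamma_kernel z x.
Proof. by rewrite mulr_ge0// ?expR_ge0// ltW. Qed.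

Lemma measurable_gamma_kernel z D : measurable_fun D (gamma_kernel z).
Proof.
apply: measurable_funTS; apply: measurable_funM => //.
apply: measurableT_comp; first exact: measurable_expR.
apply: measurable_funB.
  apply: measurable_funM => //; apply: measurableT_comp.
    exact: measurable_ln.
  exact: measurable_funM.
exact: measurable_funM.
Qed.

(** This is y^z e^(-y) at y = lam x, the boundary term in the integration by parts behind Gamma(z +
    1) = z Gamma(z). *)
Definition gamma_antideriv z x : R := expR (z * ln (lam * x) - lam * x).

Lemma is_derive_antideriv z x : 0 < x ->
  is_derive x 1 (gamma_antideriv z) (z * gamma_kernel (z - 1) x - gamma_kernel z x).
Proof.
move=> x0; have lx0 : 0 < lam * x by rewrite mulr_gt0.
have dm : is_derive x 1 ( *%R lam) lam.
  by apply: is_derive_eq; rewrite scaler1.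
have dl := is_derive1_ln lx0.
have dln : is_derive x 1 (fun t => ln (lam * t)) (x^-1).
  apply: (@is_derive_eq _ _ _ _ _ _ _ _ (is_derive1_comp dl dm)).
  by rewrite invfM mulrAC mulVf ?mul1r// gt_eqF.
pose g t := z * ln (lam * t) - lam * t.
have dz : is_derive x 1 g (z / x - lam) by exact: is_deriveB.
have de : is_derive (g x) 1 expR (expR (g x)) by exact: is_derive_expR.
rewrite (_ : gamma_antideriv z = expR \o g)//.
apply: (@is_derive_eq _ _ _ _ _ _ _ _ (is_derive1_comp de dz)); rewrite /g.
rewrite /gamma_kernel mulrBl mul1r.
have -> : z * ln (lam * x) - ln (lam * x) - lam * x =
  (z * ln (lam * x) - lam * x) - ln (lam * x) by ring.
rewrite [expR (_ - ln (lam * x))]expRB lnK ?posrE//.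
by field; rewrite !gt_eqF.
Qed.

Lemma derivable_gamma_kernel z x : 0 < x -> derivable (gamma_kernel z) x 1.
Proof.
by move=> x0; have [d _] := is_derive_antideriv z x x0; apply: derivableM.
Qed.

Lemma gamma_kernel_within_continuous z a b : 0 < a ->
  {within `[a, b], continuous (gamma_kernel z)}.
Proof.
move=> a0; apply: derivable_within_continuous => x.
rewrite in_itv/= => /andP[ax _].
by apply: derivable_gamma_kernel; exact: lt_le_trans ax.
Qed.

Lemma integrable_gamma_kernel_segment z a b : 0 < a ->
  mu.-integrable `[a, b] (EFin \o gamma_kernel z).
Proof.
move=> a0; apply: continuous_compact_integrable; first exact: segment_compact.
exact: gamma_kernel_within_continuous.
Qed.

Lemma gamma_kernel_by_parts z a b : 0 < a -> a < b ->
  (z%:E * \int[mu]_(x in `[a, b]) (gamma_kernel (z - 1) x)%:E =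
   \int[mu]_(x in `[a, b]) (gamma_kernel z x)%:E +
   (gamma_antideriv z b - gamma_antideriv z a)%:E)%E.
Proof.
move=> a0 ab.
have i1 := integrable_gamma_kernel_segment z a b a0.
have i2 := integrable_gamma_kernel_segment (z - 1) a b a0.
have d x : a <= x -> derivable (gamma_antideriv z) x 1.
  by move=> ax; have [] := is_derive_antideriv z x (lt_le_trans a0 ax).
have ca x : a <= x -> {for x, continuous (gamma_antideriv z)}.
  by move=> ax; apply/differentiable_continuous/derivable1_diffP/d.
have := @continuous_FTC2 R
  (fun x => z * gamma_kernel (z - 1) x - gamma_kernel z x) (gamma_antideriv z) a b ab.
rewrite (_ : (\int[mu]_(x in _) _)%E =
  (z%:E * \int[mu]_(x in `[a, b]) (gamma_kernel (z - 1) x)%:E -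
   \int[mu]_(x in `[a, b]) (gamma_kernel z x)%:E)%E); last first.
  rewrite -integralZl//= -integralB_EFin//=.
  exact: (integrableZl _ _ i2).
rewrite EFinB => <-.
- rewrite addeCA subee ?adde0//; apply: integrable_fin_num => //.
- apply: derivable_within_continuous => x; rewrite in_itv/= => /andP[ax _].
  have x0 := lt_le_trans a0 ax; apply: derivableB.
    by apply: derivableM => //; exact: derivable_gamma_kernel.
  exact: derivable_gamma_kernel.
- split=> [x| |].
  + by rewrite in_itv/= => /andP[/ltW ax _]; exact: d.
  + by apply: cvg_at_right_filter; exact: ca.
  + by apply: cvg_at_left_filter; apply: ca; exact: ltW.
- move=> x; rewrite in_itv/= => /andP[ax _].
  have [_ <-] := is_derive_antideriv z x (lt_trans a0 ax).
  by rewrite derive1E.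
Qed.

(** Compact intervals exhausting (0, oo) that avoid the singularity of [ln] at 0. The shift by 2
    makes the left end strictly smaller than the right one. *)
Let segment n : set R := `[(n.+2%:R)^-1, n.+2%:R].

Let bigcup_segment : \bigcup_n segment n = `]0, +oo[%classic.
Proof.
apply/seteqP; split=> x /=.
  by move=> [n _]; rewrite /segment/= !in_itv/= andbT => /andP[+ _]; apply: lt_le_trans.
rewrite in_itv/= andbT => x0.
have xx0 : 0 <= x + x^-1 by rewrite addr_ge0// ?invr_ge0 ltW.
have := archi_boundP xx0; set N := Num.bound _ => xN.
have xi0 : 0 < x^-1 by rewrite invr_gt0.
exists N => //; rewrite /segment/= in_itv/=.
have N2 : (N%:R : R) <= N.+2%:R by rewrite ler_nat leqW.
apply/andP; split; last by apply: ltW; lra.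
rewrite -[leRHS]invrK lef_pV2 ?posrE ?ltr0n//; apply: ltW; lra.
Qed.

Let cvg_gamma_moment z :
  (\int[mu]_(x in segment n) (gamma_kernel z x)%:E)%E @[n --> \oo] -->
  gamma_moment z.
Proof.
rewrite /gamma_moment -bigcup_segment.
apply: ge0_nondecreasing_set_cvg_integral.
- apply/nondecreasing_seqP => n; rewrite subsetEset /segment => x /=.
  rewrite !in_itv/= => /andP[h1 h2]; apply/andP; split.
    by apply: le_trans h1; rewrite lef_pV2 ?posrE ?ltr0n// ler_nat.
  by apply: (le_trans h2); rewrite ler_nat.
- by move=> n; exact: measurable_itv.
- by move=> n; apply/measurable_EFinP; exact: measurable_gamma_kernel.
- by move=> n x _; rewrite lee_fin gamma_kernel_ge0.
Qed.

Lemma cvg_gamma_antideriv0 z : 0 < z ->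
  gamma_antideriv z (n.+2%:R)^-1 @[n --> \oo] --> 0.
Proof.
move=> z0.
pose u (n : nat) : R := lam * (n.+2%:R)^-1.
have u0 n : 0 < u n by rewrite mulr_gt0// invr_gt0 ltr0n.
have cu : u n @[n --> \oo] --> 0.
  rewrite -[X in _ --> X](mulr0 lam); apply: cvgM; first exact: cvg_cst.
  move: (@cvg_harmonic R); rewrite -cvg_shiftS => h.
  exact: h.
have cp : (u n) `^ z @[n --> \oo] --> 0.
  have /cvg_at_rightP h := powR_cvg0 z0.
  by apply: h; split.
apply: (@squeeze_cvgr _ _ _ _ (cst 0) _ _ _ _ (cvg_cst 0) cp).
apply: nearW => n; rewrite /gamma_antideriv expR_ge0/= /powR gt_eqF//.
rewrite ler_expR gerBl; exact: ltW (u0 n).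
Qed.

Lemma cvg_gamma_antiderivy z : 0 < z ->
  gamma_antideriv z n.+2%:R @[n --> \oo] --> 0.
Proof.
move=> z0.
(* From [ln x <= x - 1] at x = t/(2z): z ln t <= z ln(2z) - z + t/2. The boundary term at t = lam
   (n+2) is thus at most C e^(-t/2). *)
pose C := expR (z * ln (2 * z) - z).
have c0 : C * expR (- (lam / 2 * n.+2%:R)) @[n --> \oo] --> 0.
  rewrite -[X in _ --> X](mulr0 C); apply: cvgM; first exact: cvg_cst.
  have l2 : 0 < lam / 2 by rewrite divr_gt0.
  have n2y : (n.+2%:R : R) @[n --> \oo] --> +oo.
    by have := @cvgr_idn R; rewrite -(cvg_shiftn 2); under eq_fun do rewrite addn2.
  have ly : lam / 2 * x @[x --> +oo] --> +oo by exact: gt0_cvgMry.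
  exact: (cvg_comp _ _ (cvg_comp _ _ n2y ly) (@cvgr_expR R)).
apply: (@squeeze_cvgr _ _ _ _ (cst 0) _ _ _ _ (cvg_cst 0) c0).
apply: nearW => n; rewrite /gamma_antideriv expR_ge0/= -expRD ler_expR.
set t := lam * n.+2%:R.
have t0 : 0 < t by rewrite mulr_gt0// ltr0n.
have := lnB1_le (t / (2 * z)); rewrite divr_gt0 ?mulr_gt0// => /(_ isT).
rewrite ln_div ?posrE ?mulr_gt0//.
rewrite -(ler_pM2l z0) (_ : z * (t / (2 * z) - 1) = t / 2 - z); last by field; lra.
by rewrite (_ : lam / 2 * _ = t / 2) ?/t; [lra | ring].
Qed.

(** The functional equation of Gamma, as the limit of integration by parts over the segments; both
    boundary terms vanish since z > 0. It holds in the extended reals, before finiteness is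
    known. *)
Lemma gamma_momentM z : 0 < z ->
  (z%:E * gamma_moment (z - 1) = gamma_moment z)%E.
Proof.
move=> z0.
have h1 : (z%:E * \int[mu]_(x in segment n) (gamma_kernel (z - 1) x)%:E)%E
    @[n --> \oo] --> (z%:E * gamma_moment (z - 1))%E.
  by apply: cvgeZl.
suff h2 : (z%:E * \int[mu]_(x in segment n) (gamma_kernel (z - 1) x)%:E)%E
    @[n --> \oo] --> gamma_moment z.
  exact: (cvg_unique _ h1 h2).
rewrite -[X in _ --> X]adde0.
rewrite (_ : (fun n => _) = (fun n =>
   \int[mu]_(x in segment n) (gamma_kernel z x)%:E +
   (gamma_antideriv z n.+2%:R - gamma_antideriv z (n.+2%:R)^-1)%:E)%E); last first.
  apply/funext => n; apply: gamma_kernel_by_parts.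
    by rewrite invr_gt0 ltr0n.
  by rewrite (@lt_trans _ _ 1)// ?ltr1n// invf_lt1 ?ltr1n ?ltr0n.
apply: cvgeD; [by rewrite fin_num_adde_defl| exact: cvg_gamma_moment|].
apply: cvg_EFin; first exact: nearW.
rewrite -[X in _ --> X](subr0 0).
by apply: cvgB; [exact: cvg_gamma_antiderivy | exact: cvg_gamma_antideriv0].
Qed.

(** Up to the factor 1/(1-r) the integrand is the exponential density of rate lam (1-r), which has
    total mass 1. *)
Lemma integral_exp_tilt r : r < 1 ->
  (\int[mu]_(x in `]0%R, +oo[) (lam * expR (r * (lam * x) - lam * x))%:E =
   ((1 - r)^-1)%:E)%E.
Proof.
move=> r1; pose rate := lam * (1 - r).
have rate0 : 0 < rate by rewrite mulr_gt0// subr_gt0.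
have m : measurable_fun setT (exponential_pdf rate) by exact: measurable_exponential_pdf.
under eq_integral.
  move=> x; rewrite inE/= in_itv/= andbT => /ltW x0.
  rewrite (_ : lam * expR _ = (1 - r)^-1 * exponential_pdf rate x); last first.
    rewrite exponential_pdfE// /rate.
    rewrite (_ : - (lam * (1 - r)) * x = r * (lam * x) - lam * x); last by ring.
    by move: (expR _) => E; field; lra.
  rewrite EFinM; over.
rewrite ge0_integralZl_EFin//; last 3 first.
- by move=> x _; rewrite lee_fin exponential_pdf_ge0// ltW.
- by apply/measurable_EFinP; exact: measurable_funTS.
- by rewrite invr_ge0; lra.
rewrite integral_itv_obnd_cbnd; last by apply/measurable_EFinP; exact: measurable_funTS.
rewrite (_ : (\int[mu]_(x in _) _)%E = 1%E) ?mule1//.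
rewrite -(integral_exponential_pdf rate0) integral_mkcond; apply: eq_integral => x _.
rewrite patchE /=; case: ifPn => //; rewrite /exponential_pdf patchE => /negbTE.
by move=> ->.
Qed.

Lemma gamma_moment0 : gamma_moment 0 = 1%E.
Proof.
rewrite -[RHS]/(1%:E) -[1 in RHS]invr1 -[X in X^-1](subr0 1) -integral_exp_tilt ?ltr01//.
by apply: eq_integral => x _; rewrite /gamma_kernel !mul0r.
Qed.

Lemma gamma_moment_nat n : gamma_moment n%:R = (n`!%:R)%:E.
Proof.
elim: n => [|n ih]; first exact: gamma_moment0.
rewrite -gamma_momentM ?ltr0n// -natr1 addrK ih -EFinM natr1 factS natrM.
by rewrite mulr_natl -mulr_natr.
Qed.

Lemma gamma_moment_prod r n : -1 < r ->
  ((\prod_(k < n) (k.+1%:R + r))%:E * gamma_moment r = gamma_moment (n%:R + r))%E.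
Proof.
move=> r1; elim: n => [|n ih]; first by rewrite big_ord0 mul1e add0r.
rewrite big_ord_recr/= mulrC EFinM -muleA ih -(gamma_momentM (n.+1%:R + r)); last first.
  by have : (0 : R) <= n%:R; [exact: ler0n | rewrite -natr1; lra].
by congr (_ * gamma_moment _)%E; rewrite -natr1; ring.
Qed.

(** Weighted AM-GM for 1 and t/N: the tangent to [ln] at their mean S bounds both logarithms, and
    the linear terms cancel when averaged with weights 1 - p and p. *)
Lemma expR_mulr_ln_le p t N : 0 <= p <= 1 -> 0 < t -> 0 < N ->
  expR (p * ln t) <= expR (p * ln N) * (1 - p + p * (t / N)).
Proof.
move=> /andP[p0 p1] t0 N0.
have tN : 0 < t / N by rewrite divr_gt0.
have [S SE] : exists S, S = 1 - p + p * (t / N) by eexists.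
rewrite -SE.
have S0 : 0 < S.
  have pt := mulr_ge0 p0 (ltW tN); rewrite SE; case: (ltP p 1) => p1'; first by lra.
  by rewrite (_ : p = 1) ?mul1r; lra.
have h1 := lnB1_le (t / N / S); rewrite ln_div ?posrE// in h1.
have {}h1 := h1 (divr_gt0 tN S0).
have h2 := lnB1_le (S^-1); rewrite lnV ?posrE// in h2.
have {}h2 := h2 (_ : 0 < S^-1); rewrite invr_gt0 in h2; have {}h2 := h2 S0.
rewrite -[S in leRHS](@lnK R) ?posrE// -expRD ler_expR.
rewrite ln_div ?posrE// in h1.
have e : p * (t / N / S - 1) + (1 - p) * (S^-1 - 1) = 0.
  transitivity ((1 - p + p * (t / N)) / S - 1).
    by field; apply/andP; split; lra.
  by rewrite -SE divff ?subrr// gt_eqF.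
have := ler_wpM2l p0 h1.
have := @ler_wpM2l _ (1 - p) _ _ _ h2; rewrite subr_ge0 => /(_ p1).
lra.
Qed.

End GammaMoments.

(** * Upper bounds for the Gamma function near 1 *)

Section GammaBound.
Context {R : realType}.
Variable lam : R.
Hypothesis lam0 : 0 < lam.
Notation mu := (@lebesgue_measure R).
Implicit Types x z r p : R.

(** Log-convexity of Gamma in usable form: the AM-GM bound on (lam x)^p, integrated against the
    kernel of order n, leaves only the moments n! and (n+1)!. *)
Lemma gamma_moment_interp n p N : 0 <= p <= 1 -> 0 < N ->
  (gamma_moment lam (n%:R + p) <=
   (expR (p * ln N) * n`!%:R * (1 - p + p * (n.+1%:R / N)))%:E)%E.
Proof.
move=> p01 N0; have /andP[p0 p1] := p01.
pose c0 := expR (p * ln N) * (1 - p); pose c1 := expR (p * ln N) * (p / N).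
have c00 : 0 <= c0 by rewrite mulr_ge0 ?expR_ge0// subr_ge0.
have c10 : 0 <= c1 by rewrite mulr_ge0 ?expR_ge0// divr_ge0// ltW.
have k0 z x : (0 <= (gamma_kernel lam z x)%:E)%E.
  by rewrite lee_fin gamma_kernel_ge0.
have mk z (D : set R) : measurable_fun D (EFin \o gamma_kernel lam z).
  by apply/measurable_EFinP; exact: measurable_gamma_kernel.
have momZ c z : 0 <= c -> (c%:E * gamma_moment lam z =
    \int[mu]_(x in `]0%R, +oo[) (c%:E * (gamma_kernel lam z x)%:E))%E.
  by move=> cge0; rewrite ge0_integralZl_EFin//; exact: mk.
apply: (@le_trans _ _ (c0%:E * gamma_moment lam n%:R + c1%:E * gamma_moment lam n.+1%:R)%E).
  rewrite !momZ//.
  rewrite -ge0_integralD//; last 4 first.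
  - by move=> x _; rewrite mule_ge0.
  - by apply: emeasurable_funM => //; exact: mk.
  - by move=> x _; rewrite mule_ge0.
  - by apply: emeasurable_funM => //; exact: mk.
  apply: ge0_le_integral => //.
  - exact: mk.
  - by apply: emeasurable_funD; apply: emeasurable_funM => //; exact: mk.
  move=> x; rewrite /= in_itv/= andbT => x0.
  have lx : 0 < lam * x by rewrite mulr_gt0.
  rewrite -!EFinM -EFinD lee_fin /gamma_kernel.
  have -> : (n%:R + p) * ln (lam * x) - lam * x =
    (n%:R * ln (lam * x) - lam * x) + p * ln (lam * x) by ring.
  have -> : n.+1%:R * ln (lam * x) - lam * x =
    (n%:R * ln (lam * x) - lam * x) + ln (lam * x) by rewrite -natr1; ring.
  rewrite !(expRD (n%:R * ln (lam * x) - lam * x)) (@lnK _ (lam * x)) ?posrE// /c0 /c1.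
  have := expR_mulr_ln_le p (lam * x) N p01 lx N0.
  set E := expR (_ - _) => h.
  have E0 : 0 <= lam * E by rewrite mulr_ge0 ?expR_ge0// ltW.
  have := ler_wpM2l E0 h; rewrite mulrA => /le_trans; apply.
  by rewrite le_eqVlt; apply/orP; left; apply/eqP; ring.
rewrite !gamma_moment_nat// -!EFinM -EFinD lee_fin factS natrM /c0 /c1.
by rewrite le_eqVlt; apply/orP; left; apply/eqP; ring.
Qed.

(** Interpolate with N = n+1: from n+1 upwards for r >= 0, and from n with p = 1 + r for r < 0,
    where the last factor of the interpolation bound is exactly 1. *)
Lemma gamma_moment_natD_le n r : `|r| <= 1 ->
  (gamma_moment lam (n.+1%:R + r) <=
   (expR (r * ln n.+1%:R) * n.+1`!%:R * expR (`|r| / n.+1%:R))%:E)%E.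
Proof.
move=> r1; have N0 : 0 < n.+1%:R :> R by rewrite ltr0n.
have [r0|r0] := leP 0 r.
  rewrite ger0_norm// in r1 *.
  apply: (le_trans (gamma_moment_interp n.+1 r _ _ N0)); first by rewrite r0.
  rewrite lee_fin ler_wpM2l// ?mulr_ge0 ?expR_ge0//.
  apply: le_trans (expR_ge1Dx _).
  rewrite -[n.+2%:R]natr1; move: (n.+1%:R) N0 => N N0.
  by rewrite le_eqVlt; apply/orP; left; apply/eqP; field; lra.
rewrite ltr0_norm// in r1 *.
have -> : n.+1%:R + r = n%:R + (1 + r) by rewrite -natr1; ring.
apply: (le_trans (gamma_moment_interp n (1 + r) _ _ N0)); first by apply/andP; split; lra.
rewrite lee_fin divff ?gt_eqF// mulr1 mulrDl mul1r expRD lnK ?posrE//.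
rewrite (_ : 1 - (1 + r) + (1 + r) = 1) ?mulr1; last by ring.
rewrite factS natrM -[_ * n`!%:R]mulrA [_ * (expR _ * _)]mulrCA.
rewrite mulrA -!mulrA ler_wpM2l ?expR_ge0// mulrA -[leLHS]mulr1.
rewrite ler_wpM2l ?mulr_ge0//.
by rewrite -expR0 ler_expR divr_ge0// ltW// oppr_gt0.
Qed.

Lemma sum_inv_sqr_le n : \sum_(k < n.+1) (k.+1%:R ^+ 2)^-1 <= 2 - n.+1%:R^-1 :> R.
Proof.
elim: n => [|n ih]; first by rewrite big_ord1 expr1n invr1; lra.
rewrite big_ord_recr/=; apply: (le_trans (lerD ih (lexx _))).
have N0 : 0 < n.+1%:R :> R by rewrite ltr0n.
rewrite -[n.+2%:R]natr1; move: (n.+1%:R) N0 => N N0.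
rewrite -subr_ge0.
have -> : 2 - (N + 1)^-1 - (2 - N^-1 + ((N + 1) ^+ 2)^-1) = (N * (N + 1) ^+ 2)^-1.
  by field; lra.
by rewrite invr_ge0 mulr_ge0// ?sqr_ge0// ltW.
Qed.

(** Divide the bound at n+1+r by the product of the k+1+r. After removing (n+1)!, the factors 1/(1 +
    r/(k+1)) are at most exponentials whose exponents sum to -r times the harmonic sum plus at most
    4 r^2, because the inverse squares sum to at most 2. *)
Lemma gamma_moment_le_euler_seq n r : `|r| <= 2^-1 ->
  (gamma_moment lam r <=
   (expR (- r * euler_seq n.+1 + 4 * r ^+ 2 + `|r| / n.+1%:R))%:E)%E.
Proof.
move=> r1; have := r1; rewrite ler_norml => /andP[r2 r3].
have rk (k : nat) : `|r / k.+1%:R| <= 2^-1.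
  rewrite normrM normfV normr_nat ler_pdivrMr ?ltr0n//.
  apply: (le_trans r1); rewrite ler_peMr// ler1n//.
pose Pi := \prod_(k < n.+1) (k.+1%:R + r).
have kr (k : nat) : 0 < k.+1%:R + r by have : (1 : R) <= k.+1%:R; [rewrite ler1n|lra].
have Pi0 : 0 < Pi by apply: prodr_gt0.
have := gamma_moment_prod lam lam0 r n.+1 _; rewrite -/Pi => e.
have {}e := e (_ : -1 < r); have {}e := e (ltac:(lra)).
have r1' : `|r| <= 1 by lra.
have := gamma_moment_natD_le n r r1'; rewrite -e -lee_pdivlMl//.
move=> /le_trans; apply; rewrite -EFinM lee_fin.
have PiE : Pi^-1 <= n.+1`!%:R^-1 *
    expR (- r * (\sum_(k < n.+1) k.+1%:R^-1) + 4 * r ^+ 2).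
  have -> : Pi = n.+1`!%:R * \prod_(k < n.+1) (1 + r / k.+1%:R).
    rewrite /Pi fact_prod big_add1 big_mkord natr_prod -big_split/=.
    apply: eq_bigr => k _; rewrite mulrDr mulr1 mulrCA divff ?mulr1//.
  rewrite invfM ler_wpM2l// ?invr_ge0//.
  apply: (@le_trans _ _ (\prod_(k < n.+1)
      expR (- (r / k.+1%:R) + 2 * (r / k.+1%:R) ^+ 2))).
    rewrite -prodfV; apply: ler_prod => k _; rewrite inv1D_le_expR// invr_ge0 andbT.
    by move: (rk k); move: (r / _) => t; rewrite ler_norml => /andP[? ?]; lra.
  rewrite -expR_sum ler_expR big_split/= mulr_sumr; apply: lerD.
    by apply: ler_sum => k _; rewrite mulNr.
  rewrite (_ : \sum__ _ = 2 * r ^+ 2 * \sum_(k < n.+1) (k.+1%:R ^+ 2)^-1).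
    rewrite (_ : 4 * _ = 2 * r ^+ 2 * 2); last by ring.
    rewrite ler_wpM2l ?(mulr_ge0 _ (sqr_ge0 _))//.
    by apply: (le_trans (sum_inv_sqr_le n)); rewrite gerBl invr_ge0.
  by rewrite mulr_sumr; apply: eq_bigr => k _; rewrite exprMn exprVn mulrA.
apply: (le_trans (ler_wpM2r _ PiE)); first by rewrite !mulr_ge0 ?expR_ge0.
rewrite mulrACA; set E := expR _; rewrite [_^-1 * _]mulrC.
rewrite -[X in X * _]mulrA mulfV ?mulr1; last by rewrite gt_eqF// ltr0n fact_gt0.
rewrite /E -!expRD ler_expR /euler_seq.
by rewrite le_eqVlt; apply/orP; left; apply/eqP; ring.
Qed.

Lemma gamma_moment_le r : `|r| <= 2^-1 ->
  (gamma_moment lam r <= (expR (- euler_gamma R * r + 5 * r ^+ 2))%:E)%E.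
Proof.
move=> r1; have [->|r0] := eqVneq r 0.
  by rewrite gamma_moment0// expr0n/= !mulr0 addr0 expR0.
(* Both errors, in Euler's constant and in 1/(n+1), are made smaller than |r|/2. Each then costs
   r^2/2, which turns 4 r^2 into 5 r^2. *)
have e0 : 0 < `|r| / 2 by rewrite divr_gt0 ?normr_gt0.
have [n [nu nn]] : exists n, `|euler_gamma R - euler_seq n.+1| < `|r| / 2 /\
    n.+1%:R^-1 < `|r| / 2.
  have /cvgrPdist_lt/(_ _ e0) h1 : (@euler_seq R n.+1) @[n --> \oo] --> euler_gamma R.
    by move: (@cvg_euler_seq R); rewrite -cvg_shiftS.
  have /cvgrPdist_lt/(_ _ e0) h2 := @cvg_harmonic R.
  have [n [? b]] := @filter_ex _ _ _ _ (filterI h1 h2); exists n; split => //.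
  by move: b; rewrite sub0r normrN ger0_norm ?harmonic_ge0.
apply: (le_trans (gamma_moment_le_euler_seq n r r1)); rewrite lee_fin ler_expR.
have h1 : - r * euler_seq n.+1 <= - euler_gamma R * r + `|r| ^+ 2 / 2.
  have : r * (euler_gamma R - euler_seq n.+1) <= `|r| * (`|r| / 2).
    apply: (le_trans (ler_norm _)); rewrite normrM ler_wpM2l//; exact: ltW.
  by lra.
have h2 : `|r| / n.+1%:R <= `|r| ^+ 2 / 2.
  by rewrite expr2 -mulrA ler_wpM2l//; exact: ltW.
rewrite real_normK ?num_real// in h1 h2.
by apply: (le_trans (lerD (lerD h1 (lexx _)) h2)); rewrite le_eqVlt; apply/orP; left; apply/eqP; field.
Qed.

End GammaBound.

(** * Lower bounds for iterated integrals *)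

Section IteratedIntegral.
Context {R : realType}.
Notation mu := (@lebesgue_measure R).

(* Lebesgue's [integral] of a nonnegative function is a supremum over simple
   functions below it, so no measurability of the larger function is needed. *)
Lemma ge0_le_integralT d (T : measurableType d) (m : {measure set T -> \bar R})
    (f g : T -> \bar R) :
  (forall x, 0 <= f x)%E -> (forall x, f x <= g x)%E ->
  (\int[m]_x f x <= \int[m]_x g x)%E.
Proof.
move=> f0 fg; have g0 x : (0 <= g x)%E by exact: le_trans (fg x).
rewrite !ge0_integralTE//; apply: le_ereal_sup => _ [h /= hf <-].
by exists h => // x; exact: le_trans (hf x) (fg x).
Qed.

(** The smaller function may change sign: dropping its negative part only increases its integral. *)
Lemma le_integral_ge0 d (T : measurableType d) (m : {measure set T -> \bar R})
    (u f : T -> \bar R) :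
  (forall x, 0 <= f x)%E -> (forall x, u x <= f x)%E ->
  (\int[m]_x u x <= \int[m]_x f x)%E.
Proof.
move=> f0 uf; rewrite integralE.
apply: (@le_trans _ _ (\int[m]_x u^\+ x)%E).
  by rewrite -[leRHS]sube0 leeB// integral_ge0.
by apply: ge0_le_integralT => // x; rewrite funeposE ge_max uf f0.
Qed.

Lemma iter_lebesgue_integral_ge0 n (f : n.-tuple R -> \bar R) :
  (forall x, 0 <= f x)%E -> (0 <= iter_lebesgue_integral f)%E.
Proof.
elim: n f => [|n ih] f f0 /=; first exact: f0.
by apply: integral_ge0 => t _; exact: ih.
Qed.

(** This replaces the union bound and independence for an iterated integral of an arbitrary
    function: the minorant is a signed sum of products, so Fubini is just integration of one factor
    at a time. *)
Lemma iter_lebesgue_integral_ge_sum_prod (J : finType) n (c : J -> R)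
    (h : J -> 'I_n -> R -> R) (f : n.-tuple R -> \bar R) :
  (forall j i, mu.-integrable setT (EFin \o h j i)) ->
  (forall x, 0 <= f x)%E ->
  (forall x, (\sum_j c j * \prod_i h j i (tnth x i))%:E <= f x)%E ->
  ((\sum_j c j * \prod_i \int[mu]_t h j i t)%R%:E <=
   iter_lebesgue_integral f)%E.
Proof.
elim: n c h f => [|n ih] c h f ih_h f0 hf.
  move: (hf [tuple]) => /=; apply: le_trans; rewrite lee_fin.
  by apply: ler_sum => j _; rewrite !big_ord0.
(* [C j] absorbs the integrals over all later coordinates, leaving a linear combination of functions
   of the first one. *)
pose C j := c j * \prod_(i < n) \int[mu]_t h j (lift ord0 i) t.
have iC j : mu.-integrable setT (fun t => (C j * h j ord0 t)%:E).
  rewrite (_ : (fun t => _) = fun t => ((C j)%:E * (h j ord0 t)%:E)%E).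
    by apply: integrableZl => //; exact: ih_h.
  by apply/funext => t; rewrite EFinM.
rewrite (_ : (_)%:E = \int[mu]_t (\sum_j C j * h j ord0 t)%:E)%E; last first.
  under [RHS]eq_integral do rewrite -sumEFin.
  rewrite integral_sum// -sumEFin; apply: eq_bigr => j _.
  under eq_integral do rewrite EFinM.
  rewrite integralZl//; last exact: ih_h.
  rewrite big_ord_recl [c j * _]mulrCA -/(C j) mulrC EFinM; congr (_ * _)%E.
  by rewrite /Rintegral fineK//; apply: integrable_fin_num => //; exact: ih_h.
apply: le_integral_ge0 => t; first exact: iter_lebesgue_integral_ge0.
rewrite (_ : \sum_j _ = \sum_j (c j * h j ord0 t) *
    \prod_(i < n) \int[mu]_u h j (lift ord0 i) u); last first.
  by apply: eq_bigr => j _; rewrite /C mulrAC.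
apply: ih => // x.
apply: le_trans (hf [tuple of t :: x]); rewrite lee_fin.
apply: ler_sum => j _; rewrite big_ord_recl tnth0 mulrA.
by under [in leRHS]eq_bigr do rewrite tnthS.
Qed.

End IteratedIntegral.

(** * Chernoff bounds for the exponential distribution *)

Section Chernoff.
Context {R : realType}.
Variable lam : R.
Hypothesis lam0 : 0 < lam.
Notation mu := (@lebesgue_measure R).
Implicit Types (b : bool) (r x : R).

(* With [X] exponential of rate [lam], [stat true (lam * X)] and
   [stat false (lam * X)] have means [- gamma] and [1]. *)
Definition stat b x : R := if b then ln x else x.
Definition stat_mean b : R := if b then - euler_gamma R else 1.

(** The exponential density times e^(r stat). It vanishes at x = 0 too, so that only tuples with
    positive coordinates, where [ln] is meaningful, contribute to the lower bound. *)
Definition tilt b r x : R :=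
  if 0 < x then lam * expR (r * stat b (lam * x) - lam * x) else 0.

Lemma integral_tiltE b r :
  (\int[mu]_x (tilt b r x)%:E =
   \int[mu]_(x in `]0%R, +oo[) (lam * expR (r * stat b (lam * x) - lam * x))%:E)%E.
Proof.
rewrite [RHS]integral_mkcond; apply: eq_integral => x _.
rewrite patchE /tilt; have [x0|x0] := ltP 0 x.
  by rewrite mem_set//= in_itv/= x0.
by rewrite memNset//= in_itv/= andbT; apply/negP; rewrite -leNgt.
Qed.

Lemma tilt_ge0 b r x : 0 <= tilt b r x.
Proof. by rewrite /tilt; case: ifP => // _; rewrite mulr_ge0 ?expR_ge0// ltW. Qed.

Lemma integral_tilt_le b r : `|r| <= 2^-1 ->
  (\int[mu]_x (tilt b r x)%:E <= (expR (stat_mean b * r + 5 * r ^+ 2))%:E)%E.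
Proof.
move=> r1; rewrite integral_tiltE; case: b => /=; first exact: gamma_moment_le.
have := r1; rewrite ler_norml => /andP[r2 r3].
rewrite integral_exp_tilt//; last by lra.
rewrite lee_fin; apply: (@le_trans _ _ (expR (- - r + 2 * (- r) ^+ 2))).
  by apply: inv1D_le_expR; rewrite normrN.
by rewrite ler_expR opprK sqrrN; have := sqr_ge0 r; lra.
Qed.

Lemma integrable_tilt b r : `|r| <= 2^-1 ->
  mu.-integrable setT (EFin \o tilt b r).
Proof.
move=> r1; apply/integrableP; split.
  apply/measurable_EFinP; apply: measurable_fun_ifT => //.
    by apply: measurable_fun_ltr.
  apply: measurable_funM => //; apply: measurableT_comp; first exact: measurable_expR.
  apply: measurable_funB; last exact: measurable_funM.
  apply: measurable_funM => //; case: b => /=; last exact: measurable_funM.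
  by apply: measurableT_comp; [exact: measurable_ln|exact: measurable_funM].
under eq_integral do rewrite /= ger0_norm ?tilt_ge0//.
by apply: (le_lt_trans (integral_tilt_le b r r1)); rewrite ltry.
Qed.

Lemma prod_tilt n (b : bool) (r : 'I_n -> R) (x : n.-tuple R) :
  (forall i, 0 < tnth x i) ->
  \prod_i tilt b (r i) (tnth x i) =
  exp_density lam x * expR (\sum_i r i * stat b (lam * tnth x i)).
Proof.
move=> x0; rewrite /exp_density ifT; last by apply/forallP => i; exact: ltW.
under eq_bigr do rewrite /tilt x0.
rewrite big_split/= prodr_const card_ord -mulrA -expR_sum -expRD; congr (_ * expR _).
by rewrite big_split/= addrC mulNr mulr_sumr -sumrN.
Qed.

Lemma exp_density_ge0 n (x : n.-tuple R) : 0 <= exp_density lam x.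
Proof.
by rewrite /exp_density; case: ifP => // _; rewrite mulr_ge0 ?expR_ge0 ?exprn_ge0 ?ltW.
Qed.

(** On positive tuples the indicator of A is at least 1 minus the sum of the e^(S_j - th_j), S_j
    being the j-th tilted sum: outside A some S_j reaches its threshold. Times the density, each
    term is a product of tilts. *)
Lemma Pn_chernoff n (J : finType) (b : J -> bool) (r : J -> 'I_n -> R)
    (th : J -> R) (A : set (n.-tuple R)) :
  (forall j i, `|r j i| <= 2^-1) ->
  (forall x : n.-tuple R, (forall i, 0 < tnth x i) ->
    (forall j, \sum_i r j i * stat (b j) (lam * tnth x i) < th j) -> A x) ->
  ((1 - \sum_j expR (\sum_i (stat_mean (b j) * r j i + 5 * r j i ^+ 2) - th j))%:E
   <= Pn lam A)%E.
Proof.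
move=> r1 HA.
(* The extra index carries the constant 1, as a product of tilts with r = 0, each of integral 1. *)
pose c (o : unit + J) : R := if o is inr j then - expR (- th j) else 1.
pose h (o : unit + J) (i : 'I_n) : R -> R :=
  if o is inr j then tilt (b j) (r j i) else tilt false 0.
have z1 : `|0 : R| <= 2^-1 by rewrite normr0 invr_ge0.
have ih o i : mu.-integrable setT (EFin \o h o i).
  by case: o => [_|j] /=; exact: integrable_tilt.
apply: le_trans (iter_lebesgue_integral_ge_sum_prod _ n c h _ ih _ _).
- rewrite lee_fin big_sumType/= big_const card_unit/= addr0 mul1r.
  have -> : \prod_(i < n) \int[mu]_t tilt false 0 t = 1.
    rewrite big1// => i _; rewrite /Rintegral integral_tiltE.
    by rewrite integral_exp_tilt ?subr0 ?invr1.
  rewrite lerD2l -sumrN; apply: ler_sum => j _.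
  rewrite mulNr lerN2 expRD mulrC ler_wpM2r ?expR_ge0// expR_sum.
  apply: ler_prod => i _; rewrite Rintegral_ge0/=; last by move=> *; exact: tilt_ge0.
  rewrite -lee_fin /Rintegral fineK ?integral_tilt_le//.
  by apply: integrable_fin_num => //; exact: integrable_tilt.
- move=> x; rewrite lee_fin mulr_ge0 ?exp_density_ge0//.
move=> x; rewrite lee_fin.
have [x0|] := boolP [forall i, 0 < tnth x i]; last first.
  rewrite negb_forall => /existsP[i xi].
  rewrite big1 ?mulr_ge0 ?exp_density_ge0// => o _.
  by rewrite (bigD1 i)//=; case: o => [?|?] /=; rewrite /tilt (negbTE xi) mul0r mulr0.
have {}x0 i : 0 < tnth x i by exact: (forallP x0).
rewrite big_sumType/= big_const card_unit/= addr0 mul1r.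
rewrite (prod_tilt n false (fun=> 0))// [\sum_(i < n) _]big1 ?expR0 ?mulr1; last first.
  by move=> i _; rewrite mul0r.
under eq_bigr do rewrite prod_tilt// mulNr mulrCA -expRD.
rewrite sumrN -mulr_sumr indicE.
have d0 := exp_density_ge0 n x.
case: (boolP (x \in A)) => xA.
  rewrite mul1r lerBlDr lerDl mulr_ge0// sumr_ge0// => j _; exact: expR_ge0.
rewrite mul0r subr_le0 ler_peMr//.
have [j jth] : exists j, th j <= \sum_i r j i * stat (b j) (lam * tnth x i).
    apply: contrapT => /forallNP H; move/negP : xA; apply; rewrite inE.
  by apply: HA => // j; rewrite ltNge; apply/negP/H.
rewrite (bigD1 j)//=; apply: ler_wpDr; first by apply: sumr_ge0 => *; exact: expR_ge0.
by rewrite -expR0 ler_expR; lra.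
Qed.

End Chernoff.

(** * The ratio of means *)

Section Ratio.
Context {R : realType}.
Implicit Types (lam c g k : R).

Lemma wmax_ge n (a : 'I_n -> R) i : a i <= wmax a.
Proof. exact: (le_bigmax _ a i). Qed.

Lemma wmin_le n (a : 'I_n -> R) i : wmin a <= a i.
Proof. exact: (bigmin_le_cond _ a). Qed.

Lemma wmax_gt0 n (a : 'I_n -> R) : (0 < n)%N -> (forall i, 0 < a i) -> 0 < wmax a.
Proof. by case: n a => // n a _ a0; apply: lt_le_trans (wmax_ge _ a ord0). Qed.

Lemma wmin_gt0 n (a : 'I_n -> R) : (0 < n)%N -> (forall i, 0 < a i) -> 0 < wmin a.
Proof. by move=> n0 a0; apply: lt_bigmin => // *; exact: wmax_gt0. Qed.

Lemma natM_wmax_ge1 n (a : 'I_n -> R) : \sum_i a i = 1 -> 1 <= n%:R * wmax a.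
Proof.
move=> a1; rewrite -[leLHS]a1 mulr_natl -[n in _ *+ n]card_ord -sumr_const.
by apply: ler_sum => i _; exact: wmax_ge.
Qed.

Lemma natM_wmin_le1 n (a : 'I_n -> R) : \sum_i a i = 1 -> n%:R * wmin a <= 1.
Proof.
move=> a1; rewrite -[leRHS]a1 mulr_natl -[n in _ *+ n]card_ord -sumr_const.
by apply: ler_sum => i _; exact: wmin_le.
Qed.

Lemma weighted_sum_gt0 n (a y : 'I_n -> R) : (0 < n)%N ->
  (forall i, 0 < a i) -> (forall i, 0 < y i) -> 0 < \sum_i a i * y i.
Proof.
case: n a y => // n a y _ a0 y0; rewrite big_ord_recl ltr_pwDl ?mulr_gt0//.
by apply: sumr_ge0 => i _; rewrite mulr_ge0// ltW.
Qed.

(** Scale invariance: as the weights sum to 1, both means scale by [lam]. *)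
Lemma gm_am_ratioE lam n (a : 'I_n -> R) (x : n.-tuple R) : 0 < lam -> (0 < n)%N ->
  (forall i, 0 < a i) -> \sum_i a i = 1 -> (forall i, 0 < tnth x i) ->
  gm_am_ratio a x = expR (\sum_i a i * ln (lam * tnth x i) -
                          ln (\sum_i a i * (lam * tnth x i))).
Proof.
move=> lam0 n0 a0 a1 x0; have S0 := weighted_sum_gt0 n a (tnth x) n0 a0 x0.
have -> : \sum_i a i * (lam * tnth x i) = lam * \sum_i a i * tnth x i.
  by rewrite mulr_sumr; apply: eq_bigr => i _; rewrite mulrCA.
have -> : \sum_i a i * ln (lam * tnth x i) = ln lam + \sum_i a i * ln (tnth x i).
  under eq_bigr do rewrite lnM ?posrE// mulrDr.
  by rewrite big_split/= -mulr_suml a1 mul1r.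
rewrite lnM ?posrE// opprD addrACA subrr add0r expRB lnK ?posrE//.
rewrite /gm_am_ratio expR_sum; congr (_ / _); apply: eq_bigr => i _.
by rewrite /powR gt_eqF.
Qed.

(* Weighted AM-GM with weight [a i - wmin a] on [y i] and the remaining weight
   [n * wmin a] on the arithmetic mean of [y]. *)
Lemma sum_ln_le_wmin n (a y : 'I_n -> R) : (0 < n)%N ->
  (forall i, 0 < a i) -> \sum_i a i = 1 -> (forall i, 0 < y i) ->
  \sum_i a i * ln (y i) - ln (\sum_i a i * y i) <=
  wmin a * (\sum_i ln (y i) - n%:R * ln ((\sum_i y i) / n%:R)).
Proof.
move=> n0 a0 a1 y0; have S0 := weighted_sum_gt0 n a y n0 a0 y0.
have m0 := wmin_gt0 n a n0 a0.
have n0' : 0 < n%:R :> R by rewrite ltr0n.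
have Y0 : 0 < \sum_i y i.
  have := weighted_sum_gt0 n (fun=> 1) y n0 (fun=> ltr01) y0.
  by under eq_bigr do rewrite mul1r.
set S := \sum_i a i * y i in S0 *; set Y := \sum_i y i in Y0 *.
have tangent z : 0 < z -> ln z <= ln S + z / S - 1.
  move=> z0; have := lnB1_le (z / S) (divr_gt0 z0 S0).
  by rewrite ln_div ?posrE//; lra.
have h1 : \sum_i (a i - wmin a) * ln (y i) <=
    \sum_i (a i - wmin a) * (ln S + y i / S - 1).
  apply: ler_sum => i _; apply: ler_wpM2l; last exact: tangent.
  by rewrite subr_ge0 wmin_le.
have h2 : n%:R * wmin a * ln (Y / n%:R) <=
    n%:R * wmin a * (ln S + Y / n%:R / S - 1).
  apply: ler_wpM2l; last by apply: tangent; rewrite divr_gt0.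
  by rewrite mulr_ge0// ltW.
have e1 : \sum_i (a i - wmin a) * ln (y i) =
    \sum_i a i * ln (y i) - wmin a * \sum_i ln (y i).
  by rewrite mulr_sumr -sumrB; apply: eq_bigr => i _; rewrite mulrBl.
have e2 : \sum_i (a i - wmin a) * (ln S + y i / S - 1) =
    (1 - n%:R * wmin a) * (ln S - 1) + (S - wmin a * Y) / S.
  transitivity (\sum_i ((a i - wmin a) * (ln S - 1) +
      (a i * y i - wmin a * y i) / S)); first by apply: eq_bigr => i _; ring.
  rewrite big_split/= -!mulr_suml !sumrB a1 sumr_const card_ord -mulr_sumr.
  by rewrite -[_ *+ n]mulr_natl.
have e3 : (1 - n%:R * wmin a) * (ln S - 1) + (S - wmin a * Y) / S +
    n%:R * wmin a * (ln S + Y / n%:R / S - 1) = ln S.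
  by field; apply/andP; split; rewrite gt_eqF.
by move: (lerD h1 h2); rewrite e1 e2 e3; lra.
Qed.

(** With M = n wmax, the two weighted deviations add up to g (M - 1) + 2 c, which gives the lower
    bound. The uniform ones put the log-ratio of the unweighted means below -g + 3 c, and n wmin <=
    1 keeps the error at 3 c. *)
Lemma gm_am_ratio_bounds lam c g n (a : 'I_n -> R) (x : n.-tuple R) :
  0 < lam -> (0 < n)%N -> (forall i, 0 < a i) -> \sum_i a i = 1 ->
  0 < c <= 2^-1 -> 0 < g -> (forall i, 0 < tnth x i) ->
  let y i := lam * tnth x i in
  - (g + (c + g * (n%:R * wmax a - 1) / 2)) < \sum_i a i * ln (y i) ->
  \sum_i a i * y i < 1 + (c + g * (n%:R * wmax a - 1) / 2) ->
  \sum_i ln (y i) < n%:R * (- g + c) ->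
  n%:R * (1 - c) < \sum_i y i ->
  expR (- (n%:R * wmax a * g) - 3 * c) < gm_am_ratio a x <
  expR (- (n%:R * wmin a * g) + 3 * c).
Proof.
move=> lam0 n0 a0 a1 /andP[c0 c1] g0 x0 y E1 E2 E3 E4.
have y0 i : 0 < y i by rewrite mulr_gt0.
have M1 := natM_wmax_ge1 n a a1; have m1 := natM_wmin_le1 n a a1.
have m0 := wmin_gt0 n a n0 a0.
have n0' : 0 < n%:R :> R by rewrite ltr0n.
have S0 := weighted_sum_gt0 n a y n0 a0 y0.
rewrite (gm_am_ratioE lam)// !ltr_expR; apply/andP; split.
  have h : ln (\sum_i a i * y i) <= \sum_i a i * y i - 1 by exact: lnB1_le.
  by move: E1 E2 h; rewrite /y; move: (\sum_i _) (\sum_i _) (ln _) => *; lra.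
apply: (le_lt_trans (sum_ln_le_wmin n a y n0 a0 a1 y0)).
(* Here 1/(1-c) <= e^(c + 2 c^2) <= e^(2 c), as c <= 1/2. *)
have lnY : - (2 * c) <= ln ((\sum_i y i) / n%:R).
  have c0' : 0 < 1 - c by lra.
  apply: (@le_trans _ _ (ln (1 - c))); last first.
    have q0 : 1 - c < (\sum_i y i) / n%:R by rewrite ltr_pdivlMr// mulrC.
    by rewrite ler_ln ?posrE ?(ltW q0)//; exact: lt_trans q0.
  rewrite -ler_expR lnK ?posrE// expRN -[leRHS]invrK lef_pV2 ?posrE ?invr_gt0 ?expR_gt0//.
  apply: (le_trans (@inv1D_le_expR _ (- c) _)); last by rewrite ler_expR; nra.
  by rewrite normrN gtr0_norm.
have h : \sum_i ln (y i) - n%:R * ln ((\sum_i y i) / n%:R) < n%:R * (- g + 3 * c).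
  have := ler_wpM2l (ltW n0') lnY; move: E3.
  by move: (\sum_i _) (ln _) => *; lra.
have : wmin a * (\sum_i ln (y i) - n%:R * ln ((\sum_i y i) / n%:R)) <
    wmin a * (n%:R * (- g + 3 * c)) by rewrite ltr_pM2l.
move=> /lt_le_trans; apply.
have : n%:R * wmin a * (3 * c) <= 1 * (3 * c) by apply: ler_wpM2r => //; lra.
by lra.
Qed.

Lemma exp_decay_le_powR k eta C : 0 < k -> 0 < eta -> 0 < C ->
  exists N : nat, forall n : nat, (0 < n)%N -> (N <= n)%N ->
    C * expR (- (n%:R * eta)) <= (n%:R `^ k)^-1.
Proof.
(* This t makes [ln x <= x - 1] at x = t n bound k ln n by n eta/2 plus a constant; D collects the
   constants, to be absorbed by the other half of n eta. *)
move=> k0 eta0 C0; pose t := eta / (2 * k).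
have t0 : 0 < t by rewrite divr_gt0// mulr_gt0.
pose D := ln C - k - k * ln t.
exists (Num.bound (`|D| / (eta / 2))) => n n0 Nn.
have n0' : 0 < n%:R :> R by rewrite ltr0n.
have eta20 : 0 < eta / 2 by rewrite divr_gt0.
have Dn : D <= n%:R * (eta / 2).
  apply: (le_trans (ler_norm _)); rewrite -ler_pdivrMr//.
  apply: (@le_trans _ _ (Num.bound (`|D| / (eta / 2)))%:R); last by rewrite ler_nat.
  by apply/ltW/archi_boundP; rewrite divr_ge0// ltW.
rewrite /powR gt_eqF// -expRN -[C](@lnK R) ?posrE// -expRD ler_expR.
have := lnB1_le (t * n%:R) (mulr_gt0 t0 n0'); rewrite lnM ?posrE// => h.
have := ler_wpM2l (ltW k0) h.
have -> : k * (t * n%:R - 1) = n%:R * (eta / 2) - k by rewrite /t; field; rewrite gt_eqF.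
by move: Dn; rewrite /D; move: (ln _) (ln _) (ln _) => *; lra.
Qed.

End Ratio.

(** * Concentration *)

Section ConcentrationEvent.
Context {R : realType}.
Implicit Types (lam c g s : R) (j : bool * bool).

(* [j.1] selects [ln] or the identity, [j.2] the upper or the lower tail. The
   lower tail of [ln] and the upper tail of the identity are controlled for the
   [a]-weighted means, the other two for the uniform means. *)
Definition tail_weight {n} (a : 'I_n -> R) j i : R :=
  if j.1 (+) j.2 then a i / wmax a else 1.

(** The allowed deviation of each mean. The weighted means get an extra margin that grows with n
    wmax, to make up for their weaker concentration. *)
Definition tail_slack c g {n} (a : 'I_n -> R) j : R :=
  if j.1 (+) j.2 then c + g * (n%:R * wmax a - 1) / 2 else c.

Definition tail_sign j : R := if j.2 then 1 else -1.

(** Dividing by [wmax a] keeps every tilt within the range of the moment bounds, however uneven the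
    weights are. *)
Lemma tail_weight_itv n (a : 'I_n -> R) j i : (forall i, 0 < a i) ->
  0 <= tail_weight a j i <= 1.
Proof.
move=> a0; rewrite /tail_weight; case: ifP => _; last by rewrite ler01 lexx.
have w0 : 0 < wmax a by apply: lt_le_trans (wmax_ge n a i).
apply/andP; split; first by rewrite divr_ge0// ltW.
by rewrite ler_pdivrMr// mul1r wmax_ge.
Qed.

(** In the weighted case the total weight is n/M with M = n wmax >= 1, while the slack is at least M
    min(c, g)/2; so M cancels and the rate is uniform in the weights. *)
Lemma tail_slack_ge c g n (a : 'I_n -> R) j : (0 < n)%N -> (forall i, 0 < a i) ->
  \sum_i a i = 1 -> 0 < c -> 0 < g ->
  n%:R * (Num.min c g / 2) <= (\sum_i tail_weight a j i) * tail_slack c g a j.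
Proof.
move=> n0 a0 a1 c0 g0; have w0 := wmax_gt0 n a n0 a0.
have n0' : 0 < n%:R :> R by rewrite ltr0n.
have M1 := natM_wmax_ge1 n a a1.
have qc : Num.min c g <= c by rewrite ge_min lexx.
have qg : Num.min c g <= g by rewrite ge_min lexx orbT.
have q0 : 0 < Num.min c g by rewrite lt_min c0.
move: (Num.min c g) qc qg q0 => q qc qg q0.
rewrite /tail_weight /tail_slack; case: ifP => _; last first.
  by rewrite sumr_const card_ord ler_wpM2l//; lra.
rewrite -mulr_suml a1 mul1r [leRHS]mulrC ler_pdivlMr//.
by move: (n%:R * wmax a) M1 (mulrAC n%:R (q / 2) (wmax a)) => M M1 ->; nra.
Qed.

(* With [s = c / 10] the quadratic term [5 * s ^+ 2] of the Chernoff bound uses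
   up at most half of the slack. *)
Lemma chernoff_exponent_le c g s n (a : 'I_n -> R) j : (0 < n)%N ->
  (forall i, 0 < a i) -> \sum_i a i = 1 -> 0 < c -> 0 < g -> s = c / 10 ->
  \sum_i (stat_mean j.1 * (tail_sign j * s * tail_weight a j i) +
           5 * (tail_sign j * s * tail_weight a j i) ^+ 2) -
    s * (\sum_i tail_weight a j i) *
      (tail_sign j * stat_mean j.1 + tail_slack c g a j) <=
  - (n%:R * (s * Num.min c g / 4)).
Proof.
move=> n0 a0 a1 c0 g0 sE.
set U := \sum_i tail_weight a j i; set L := (X in X - _ <= _).
have s0 : 0 < s by rewrite sE divr_gt0.
have dc : c <= tail_slack c g a j.
  rewrite /tail_slack; case: ifP => _//; rewrite lerDl mulr_ge0//.
  by rewrite mulr_ge0 ?(ltW g0)// subr_ge0 natM_wmax_ge1.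
have h := tail_slack_ge c g n a j n0 a0 a1 c0 g0.
have U0 : 0 <= U by apply: sumr_ge0 => i _; case/andP : (tail_weight_itv n a j i a0).
have sg : tail_sign j ^+ 2 = 1.
  by rewrite /tail_sign; case: ifP => _; rewrite ?sqrrN expr1n.
(* The tail weights lie in [0, 1], so their squares sum to at most U. *)
have h1 : L <=
    s * U * (tail_sign j * stat_mean j.1) + 5 * s ^+ 2 * U.
  rewrite /L /U !mulr_sumr [X in X + _]mulrC mulr_sumr -big_split/=; apply: ler_sum => i _.
  have /andP[t0 t1] := tail_weight_itv n a j i a0.
  rewrite !exprMn sg mul1r; apply: lerD.
    by rewrite le_eqVlt; apply/orP; left; apply/eqP; ring.
  rewrite -mulrA ler_wpM2l// ler_wpM2l ?sqr_ge0// expr2.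
  by rewrite -[leRHS]mulr1 ler_wpM2l.
have h2 : 5 * s ^+ 2 * U <= s * U * (tail_slack c g a j / 2).
  rewrite (_ : 5 * _ * _ = s * U * (5 * s)); last by ring.
  by rewrite ler_wpM2l ?mulr_ge0 ?(ltW s0)//; lra.
have {}h := ler_wpM2l (ltW s0) h; rewrite -/U in h; clear -h1 h2 h; move: h h1 h2.
move: L (tail_slack _ _ _ _) (stat_mean _) (tail_sign _) (Num.min _ _) => *.
lra.
Qed.

End ConcentrationEvent.

(** * From the four tail estimates to the two-sided bound *)

Theorem theorem4p4 (R : realType) (k eps : R) (hk : 0 < k) (heps : 0 < eps) :
  exists N : nat, forall (lam : R), 0 < lam ->
  forall (n : nat), (2 <= n)%N -> (N <= n)%N ->
  forall (a : 'I_n -> R), (forall i, 0 < a i) -> \sum_(i < n) a i = 1 ->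
  ((1 - (n%:R `^ k)^-1)%:E <=
   Pn lam [set x : n.-tuple R |
      ((1 - eps) * expR (- (n%:R * wmax a * euler_gamma R)) < gm_am_ratio a x
       < (1 + eps) * expR (- (n%:R * wmin a * euler_gamma R)))%R])%E.
Proof.
pose g := euler_gamma R; have g0 : 0 < g := euler_gamma_gt0.
have eps1 : 0 < 1 + eps by lra.
pose D := ln (1 + eps); have D0 : 0 < D by rewrite ln_gt0; lra.
(* Chosen so that e^(3 c) <= 1 + eps, with c <= 1/2 as the ratio bounds require. *)
pose c := Num.min (D / 3) 2^-1.
have c0 : 0 < c by rewrite lt_min !divr_gt0//= invr_gt0.
have cD : 3 * c <= D.
  have : c <= D / 3 by rewrite ge_min lexx.
  by lra.
have c1 : c <= 2^-1 by rewrite ge_min lexx orbT.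
have [s sE] : exists s, s = c / 10 by eexists.
have s0 : 0 < s by rewrite sE divr_gt0.
have q0 : 0 < Num.min c g by rewrite lt_min c0.
have eta0 : 0 < s * Num.min c g / 4 by rewrite divr_gt0// mulr_gt0.
(* The constant 4 counts the tails, one for each pair of booleans. N is fixed before [lam] and the
   weights. *)
have [N HN] := exp_decay_le_powR k _ 4 hk eta0 (ltr0n _ _).
exists N => lam lam0 n n2 Nn a a0 a1.
have n0 : (0 < n)%N by exact: leq_trans n2.
have w0 := wmax_gt0 n a n0 a0.
pose U j := \sum_i tail_weight a j i.
pose r j i := tail_sign j * s * tail_weight a j i.
pose th j := s * U j * (tail_sign j * stat_mean j.1 + tail_slack c g a j).
have P := @Pn_chernoff R lam lam0 n (bool * bool)%type fst r th.
apply: le_trans (P _ _ _) => {P}.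
- rewrite lee_fin lerD2l lerN2; apply: le_trans (HN n n0 Nn).
  rewrite [X in _ <= X * _](_ : 4 = \sum_(j : bool * bool) 1); last first.
    by rewrite sumr_const card_prod card_bool.
  rewrite mulr_suml; apply: ler_sum => j _; rewrite mul1r ler_expR.
  exact: (chernoff_exponent_le c g s n a j n0 a0 a1 c0 g0 sE).
- move=> j i; rewrite /r !normrM (_ : `|tail_sign j| = 1); last first.
    by rewrite /tail_sign; case: ifP; rewrite ?normrN normr1.
  have /andP[t0 t1] := tail_weight_itv n a j i a0.
  rewrite mul1r (gtr0_norm s0) ger0_norm//.
  apply: (@le_trans _ _ (s * 1)); first by rewrite ler_wpM2l// ltW.
  by lra.
move=> x x0 H /=.
have {}H j : tail_sign j * \sum_i tail_weight a j i * stat j.1 (lam * tnth x i) <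
    U j * (tail_sign j * stat_mean j.1 + tail_slack c g a j).
  rewrite -(ltr_pM2l s0) [ltRHS]mulrA; apply: le_lt_trans (H j).
  by rewrite !mulr_sumr; apply: ler_sum => i _; rewrite /r; lra.
(* The weights sum to 1, so the factor 1/[wmax a] cancels from both sides. *)
have weighted j : j.1 (+) j.2 -> tail_sign j * \sum_i a i * stat j.1 (lam * tnth x i) <
    tail_sign j * stat_mean j.1 + (c + g * (n%:R * wmax a - 1) / 2).
  move=> wj; have := H j; rewrite /U /tail_weight /tail_slack wj -mulr_suml a1.
  under eq_bigr do rewrite mulrAC.
  by rewrite -mulr_suml mulrA mul1r [ltRHS]mulrC ltr_pM2r ?invr_gt0.
have uniform j : ~~ (j.1 (+) j.2) -> tail_sign j * \sum_i stat j.1 (lam * tnth x i) <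
    n%:R * (tail_sign j * stat_mean j.1 + c).
  move=> /negbTE wj; have := H j.
  rewrite /U /tail_weight /tail_slack wj sumr_const card_ord.
  by under eq_bigr do rewrite mul1r.
have /andP[B1 B2] : expR (- (n%:R * wmax a * g) - 3 * c) < gm_am_ratio a x <
    expR (- (n%:R * wmin a * g) + 3 * c).
  have := weighted (true, false) isT; have := weighted (false, true) isT.
  have := uniform (true, true) isT; have := uniform (false, false) isT.
  rewrite /tail_sign /stat_mean /= -/g => h4 h3 h2 h1.
  by apply: (gm_am_ratio_bounds lam) => //; rewrite ?c0 ?c1//; lra.
apply/andP; split.
  (* Here e^(-3 c) >= 1 - 3 c >= 1 - ln(1 + eps) >= 1 - eps. *)
  apply: le_lt_trans B1; rewrite expRD mulrC ler_wpM2l ?expR_ge0//.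
  apply: le_trans (expR_ge1Dx _).
  by have := @le_ln1Dx R eps; rewrite -/D => h; have := h (ltac:(lra)); lra.
apply: (lt_le_trans B2); rewrite expRD mulrC ler_wpM2r ?expR_ge0//.
by rewrite -[leRHS](@lnK R) ?posrE// ler_expR.
Qed.
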